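(* For every constant $C>0$ there is a constant $\varepsilon>0$ such that the following holds. Let $p=p(n)$ satisfy $p<2^{-100C\sqrt n\log n}$ and $p\ge\omega(n)/2^n$ for some function $\omega(n)\to\infty$, and let $t=t(n)$ be a positive integer with $t\le C\sqrt n$. Then, with probability tending to $1$ as $n\to\infty$, the largest $t$-intersecting family in $\mathcal P(n,p)$ has size at least $(1+\varepsilon)pK(n,t)$.
   Context: A family $\mathcal A\subseteq\mathcal P(n)$ is $t$-intersecting if $|A\cap B|\ge t$ for all $A,B\in\mathcal A$. $K(n,t)$ denotes the maximum size of a $t$-intersecting family in $\mathcal P(n)$; by Katona's theorem $K(n,t)=\sum_{i\ge (n+t)/2}\binom ni$ if $n+t$ is even and $K(n,t)=2\sum_{i\ge(n+t-1)/2}\binom{n-1}{i}$ otherwise. $\mathcal P(n,p)$ is the random subfamily of $\mathcal P(n)$ including each subset of $[n]$ independently with probability $p$. Logarithms are base 2. *)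

(* Defs.v *)
From HB Require Import structures.
From mathcomp Require Import all_boot all_order all_algebra.
From mathcomp Require Import all_classical all_reals all_analysis.
Import Order.TTheory GRing.Theory Num.Theory.
Import numFieldNormedType.Exports.

Set Implicit Arguments.
Unset Strict Implicit.
Unset Printing Implicit Defensive.

Local Open Scope ring_scope.

(* [A = B] is allowed, so every member of the family has at least [t] elements. *)
Definition t_intersecting (n t : nat) (F : {set {set 'I_n}}) : bool :=
  [forall A in F, forall B in F, (t <= #|A :&: B|)%N].

Definition largest_t_intersecting (n t : nat) (F : {set {set 'I_n}}) : nat :=
  \max_(G : {set {set 'I_n}} | (G \subset F) && t_intersecting t G) #|G|.

Definition K (n t : nat) : nat :=
  largest_t_intersecting t [set: {set 'I_n}].

(* Probability of the event [E] for the random family P(n, p): the inclusions  *)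
(* of the subsets of ['I_n] are independent with probability [p], so a family  *)
(* has the product weight below.  Meaningful as a probability if 0 <= p <= 1.  *)
Definition Pr_Pnp (R : realType) (n : nat) (p : R)
    (E : pred {set {set 'I_n}}) : R :=
  \sum_(F : {set {set 'I_n}} | E F)
    \prod_(A : {set 'I_n}) (if A \in F then p else 1 - p).

Lemma Pr_PnpT (R : realType) (n : nat) (p : R) : @Pr_Pnp R n p predT = 1.
Proof.
rewrite /Pr_Pnp -(bigA_distr _ _ (fun=> p) (fun=> 1 - p)).
by rewrite big1 //= => A _; rewrite addrC subrK.
Qed.

Definition log2 (R : realType) (x : R) : R := ln x / ln 2.

(* Main.v *)
(** Complementation gives [K n t <= 2^(n-1)], so it suffices to find a
    [t]-intersecting subfamily of size [(1/2 + c) p 2^n].  Let [S] consist of the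
    sets of size at least [n/2 - a], where [a] is about [C sqrt n].  Since the
    central layers carry a constant proportion of the cube, [#|S|] exceeds
    [(1/2 + c') 2^n].  If [A, B] are in [S] and [#|A :&: B| < t], then [B] differs
    from the complement of [A] in at most [2 (a + t)] points, so [A] conflicts with
    at most [(n+1)^(2(a+t))] sets, which is far less than [1/p].  By Chebyshev the
    random family has about [p #|S|] members in [S], by Markov it contains
    [o(p 2^n)] conflicting pairs, and deleting one set from each conflicting pair
    leaves a [t]-intersecting family. *)

Require Import Defs.
From HB Require Import structures.
From mathcomp Require Import all_boot all_order all_algebra.
From mathcomp Require Import all_classical all_reals all_analysis.
From mathcomp Require Import ring lra zify.
Import Order.TTheory GRing.Theory Num.Theory.
Import numFieldNormedType.Exports.

Local Open Scope ring_scope.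

(** * Moments of a random subset of a finite type *)

(** The base type is arbitrary because two are needed: on [{set 'I_n}] this is the summand of
    [Pr_Pnp], and on ['I_n] with [p = 1/2] it is the uniform weight on the cube. *)
Definition bernoulli_weight {R : pzRingType} {T : finType} (p : R)
    (F : {set T}) : R :=
  \prod_(x : T) (if x \in F then p else 1 - p).

Lemma bernoulli_weight_ge0 (R : realFieldType) (T : finType) (p : R)
    (F : {set T}) : 0 <= p <= 1 -> 0 <= bernoulli_weight p F.
Proof.
by move=> /andP[p0 p1]; apply: prodr_ge0 => x _; case: ifP; rewrite ?subr_ge0.
Qed.

Lemma sum_bernoulli_weight_superset (R : comNzRingType) (T : finType) (p : R)
    (S : {set T}) :
  \sum_(F : {set T} | S \subset F) bernoulli_weight p F = p ^+ #|S|.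
Proof.
(* A zero factor at the points of [S] missing from [F] removes the unwanted terms. The sum then
   factors over the points, with factor [p] on [S] and [p + (1 - p) = 1] elsewhere. *)
transitivity (\sum_(F : {set T}) \prod_(x : T)
    (if x \in F then p else if x \in S then 0 else 1 - p)).
  rewrite big_mkcond; apply: eq_bigr => F _.
  case: ifP => [sSF|/negbT/subsetPn[x xS xF]].
    apply: eq_bigr => x _; case: ifP => // /negbT xF; case: ifP => // xS.
    by rewrite (fintype.subsetP sSF) in xF.
  by rewrite (bigD1 x) //= (negbTE xF) xS mul0r.
rewrite -(bigA_distr _ _ (fun=> p) (fun x => if x \in S then 0 else 1 - p)).
rewrite -prodr_const [RHS]big_mkcond; apply: eq_bigr => x _ /=.
by case: ifP; rewrite ?addr0 // addrC subrK.
Qed.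

Lemma sum_bernoulli_weight (R : comNzRingType) (T : finType) (p : R) :
  \sum_(F : {set T}) bernoulli_weight p F = 1.
Proof.
rewrite -(expr0 p) -(cards0 T) -sum_bernoulli_weight_superset.
by apply: eq_bigl => F; rewrite finset.sub0set.
Qed.

(** Linearity of expectation: each [f i] lies in the random set with probability [p ^+ k].
    Singletons give the mean size, two-point sets the mean number of pairs. *)
Lemma mean_card_superset (R : comNzRingType) (T I : finType) (p : R)
    (E : {set I}) (f : I -> {set T}) (k : nat) :
  (forall i, i \in E -> #|f i| = k) ->
  \sum_(F : {set T}) bernoulli_weight p F * #|[set i in E | f i \subset F]|%:R
    = #|E|%:R * p ^+ k.
Proof.
move=> fk; transitivity (\sum_(F : {set T}) \sum_(i in E)
    if f i \subset F then bernoulli_weight p F else 0).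
  apply: eq_bigr => F _; rewrite -big_mkcondr /= sumr_const mulr_natr.
  by congr (_ *+ _); apply: eq_card => i; rewrite !inE.
rewrite exchange_big /= mulr_natl -sumr_const; apply: eq_bigr => i iE.
by rewrite -big_mkcond sum_bernoulli_weight_superset fk.
Qed.

Lemma mean_card (R : comNzRingType) (T : finType) (p : R) (S : {set T}) :
  \sum_(F : {set T}) bernoulli_weight p F * #|F :&: S|%:R = #|S|%:R * p.
Proof.
rewrite -[in RHS](expr1 p) -(mean_card_superset _ _ _ _ _ finset.set1) => [|x _];
  last by rewrite cards1.
apply: eq_bigr => F _; congr (_ * _%:R); apply: eq_card => x.
by rewrite !inE finset.sub1set andbC.
Qed.

Lemma mean_card_pairs (R : comNzRingType) (T : finType) (p : R)
    (E : {set T * T}) :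
  (forall e, e \in E -> e.1 != e.2) ->
  \sum_(F : {set T}) bernoulli_weight p F * #|E :&: finset.setX F F|%:R
    = #|E|%:R * p ^+ 2.
Proof.
move=> neqE; rewrite -(mean_card_superset _ _ _ _ _ (fun e => [set e.1; e.2])).
  apply: eq_bigr => F _; congr (_ * _%:R); apply: eq_card => -[x y].
  by rewrite !inE finset.subUset !finset.sub1set.
by move=> e /neqE; rewrite cards2 => ->.
Qed.

Definition offdiag {T : finType} (A : {set T}) : {set T * T} :=
  [set e in finset.setX A A | e.1 != e.2].

Lemma card_offdiag (T : finType) (A : {set T}) :
  (#|A| ^ 2 = #|A| + #|offdiag A|)%N.
Proof.
rewrite expnS expn1 -cardsX -(cardsID [set e : T * T | e.1 == e.2]).
congr addn; last by apply: eq_card => e; rewrite !inE andbC.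
rewrite -(card_imset A (f := fun x => (x, x))); last by move=> x y [].
apply: eq_card => -[x y]; rewrite !inE /=.
apply/idP/imsetP; last by move=> [z zA [-> ->]]; rewrite zA eqxx.
by move=> /andP[/andP[xA _] /eqP <-]; exists x.
Qed.

(** A squared size counts the points plus the ordered pairs of distinct points, so expanding the
    square leaves only means computed above. *)
Lemma variance_card (R : comNzRingType) (T : finType) (p : R) (S : {set T}) :
  \sum_(F : {set T}) bernoulli_weight p F * (#|F :&: S|%:R - #|S|%:R * p) ^+ 2
    = #|S|%:R * (p * (1 - p)).
Proof.
set s : R := #|S|%:R.
have sq (A : {set T}) : #|A|%:R ^+ 2 = #|A|%:R + #|offdiag A|%:R :> R.
  by rewrite -natrX card_offdiag natrD.
transitivity (\sum_(F : {set T})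
    (bernoulli_weight p F * #|offdiag S :&: finset.setX F F|%:R
     + bernoulli_weight p F * #|F :&: S|%:R * (1 - s * p *+ 2)
     + bernoulli_weight p F * (s * p) ^+ 2)).
  apply: eq_bigr => F _; rewrite sqrrB sq.
  have -> : offdiag (F :&: S) = offdiag S :&: finset.setX F F.
    by apply/setP => -[x y]; rewrite !inE /=; do !case: (_ \in _); case: eqP.
  ring.
rewrite !big_split -!mulr_suml /= mean_card sum_bernoulli_weight mean_card_pairs.
  have -> : #|offdiag S|%:R = s ^+ 2 - s by rewrite sq addrC addKr.
  by rewrite -/s; ring.
by move=> e; rewrite inE => /andP[].
Qed.

(** * Sizes of the layers of the cube *)

Lemma leq_bin_half (n k l : nat) :
  (k <= l)%N -> (l.*2 <= n)%N -> ('C(n, k) <= 'C(n, l))%N.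
Proof.
elim: l => [|l IHl]; first by rewrite leqn0 => /eqP ->.
rewrite leq_eqVlt ltnS => /predU1P[-> //|kl] ln.
apply: (leq_trans (IHl kl _)); first lia.
have := mul_bin_left n l; have : (l.+1 <= n - l)%N by lia.
nia.
Qed.

Lemma card_set_sizeP (n : nat) (P : pred nat) :
  #|[set A : {set 'I_n} | P #|A|]| = (\sum_(k < n.+1 | P k) 'C(n, k))%N.
Proof.
pose size_ord (A : {set 'I_n}) : 'I_n.+1 := inord #|A|.
have szE A : size_ord A = #|A| :> nat.
  by rewrite inordK // ltnS -[X in (_ <= X)%N](card_ord n) max_card.
rewrite -sum1_card (partition_big size_ord (fun k : 'I_n.+1 => P k)) /=.
  apply: eq_bigr => k Pk; rewrite sum1_card -[X in 'C(X, _)](card_ord n).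
  rewrite -cardsT -cards_draws; apply: eq_card => A.
  rewrite [RHS]inE finset.subsetT unfold_in inE -(inj_eq val_inj) /= szE.
  by case: eqP => [->|]; rewrite ?andbF ?Pk.
by move=> A; rewrite inE szE.
Qed.

Lemma card_ord_itv (m lo L : nat) (P : pred nat) :
  (forall k, P k -> lo <= k < lo + L)%N -> (#|[pred k : 'I_m | P k]| <= L)%N.
Proof.
move=> PL; rewrite cardE -(size_map val) -[X in (_ <= X)%N](size_iota lo).
apply: uniq_leq_size; first by rewrite (map_inj_uniq val_inj) enum_uniq.
move=> _ /mapP[k + ->]; rewrite mem_enum mem_iota inE => /PL //.
Qed.

(** A set with at most [k] elements is listed by a function from ['I_k] to [option T], with [None]
    as padding. *)
Lemma card_small_sets (T : finType) (k : nat) :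
  (#|[set A : {set T} | (#|A| <= k)%N]| <= #|T|.+1 ^ k)%N.
Proof.
rewrite -card_option -[X in (_ ^ X)%N](card_ord k) -card_ffun.
pose g (f : {ffun 'I_k -> option T}) := [set x | Some x \in codom f].
rewrite -cardsT; apply: leq_trans (leq_imset_card g _).
apply/subset_leq_card/fintype.subsetP => A; rewrite inE => Ak.
apply/imsetP.
exists [ffun i : 'I_k => nth None [seq Some y | y <- enum A] i] => //.
apply/setP => x; rewrite inE; apply/idP/codomP => [xA|[i]].
  have xe : x \in enum A by rewrite mem_enum.
  have xi : (index x (enum A) < k)%N.
    by apply: leq_trans Ak; rewrite cardE index_mem.
  by exists (Ordinal xi); rewrite ffunE /= (nth_map x) ?index_mem // nth_index.
rewrite ffunE; have [iA|Ai] := ltnP i (size (enum A)).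
  by rewrite (nth_map x) // => -[->]; rewrite -mem_enum mem_nth.
by rewrite nth_default // size_map.
Qed.

(** Doubling both inequalities expresses a distance at most [a] from [n / 2] without rounding. *)
Definition middle (n a : nat) : {set {set 'I_n}} :=
  [set A : {set 'I_n} | (n <= (#|A| + a).*2)%N && (#|A|.*2 <= n + a.*2)%N].

Definition upper (n a : nat) : {set {set 'I_n}} :=
  [set A : {set 'I_n} | (n <= (#|A| + a).*2)%N].

(** Complementation maps [upper] onto [lower]; these two cover the cube and meet in [middle]. *)
Lemma card_upper (n a : nat) : (#|upper n a|.*2 = 2 ^ n + #|middle n a|)%N.
Proof.
pose lower := [set A : {set 'I_n} | (#|A|.*2 <= n + a.*2)%N].
have cardC (A : {set 'I_n}) : (#|~: A| = n - #|A|)%N.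
  by have := cardsC A; rewrite card_ord; lia.
have leA (A : {set 'I_n}) : (#|A| <= n)%N.
  by have := max_card (mem A); rewrite card_ord.
have -> : (2 ^ n)%N = #|upper n a :|: lower|.
  rewrite -[in LHS](card_ord n) -cardsT -card_powerset powersetT.
  by apply: eq_card => A; rewrite !inE; lia.
have -> : middle n a = upper n a :&: lower by apply/setP => A; rewrite !inE.
rewrite cardsUI -addnn; congr addn.
rewrite -(card_imset _ (inv_inj (@finset.setCK 'I_n))); apply: eq_card => A.
rewrite -[A in LHS]finset.setCK mem_imset ?inE ?cardC;
  last exact/inv_inj/finset.setCK.
by have := leA A; lia.
Qed.

Lemma card_wide_middle (n a J : nat) :
  (0 < J)%N -> (0 < a)%N -> (a.*2 <= n)%N ->
  (#|middle n (J * a)| <= (3 * J + 1) * #|middle n a|)%N.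
Proof.
(* ['C(n, k0)] is a lower bound for the [a] layers starting at [k0], all in the
   middle, and an upper bound for the layers outside the middle. *)
move=> J0 a0 an; set k0 := (n.+1 - a.*2)./2.
have mid_ge : (a * 'C(n, k0) <= #|middle n a|)%N.
  rewrite (card_set_sizeP n (fun k => (n <= (k + a).*2) && (k.*2 <= n + a.*2))%N).
  have [h hE] : exists h : 'I_a -> 'I_n.+1, forall i, h i = (k0 + i)%N :> nat.
    exists (fun i => inord (k0 + i)) => i.
    by rewrite inordK //; have := ltn_ord i; lia.
  rewrite -[X in (X * _)%N](card_ord a) -sum_nat_const.
  apply: (@leq_trans (\sum_(k < n.+1 | k \in [set h i | i : 'I_a]) 'C(n, k))).
    rewrite big_imset /=; last first.
      by move=> i j _ _ /(congr1 val); rewrite /= !hE => /addnI /val_inj.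
    apply: leq_sum => i _; apply: leq_bin_half; rewrite hE;
      by have := ltn_ord i; lia.
  rewrite big_mkcond [X in (_ <= X)%N]big_mkcond; apply: leq_sum => k _.
  case: imsetP => [[i _ ->]|//]; rewrite hE ifT //; have := ltn_ord i; lia.
pose wide k := [&& n <= (k + J * a).*2, k.*2 <= n + (J * a).*2 &
  ~~ ((n <= (k + a).*2) && (k.*2 <= n + a.*2))]%N.
rewrite -(cardsID (middle n a)) mulnDl mul1n addnC.
rewrite leq_add ?subset_leq_card ?finset.subsetIr //.
apply: (@leq_trans (3 * J * (a * 'C(n, k0)))); last first.
  by rewrite leq_mul2l mid_ge orbT.
have -> : middle n (J * a) :\: middle n a = [set A : {set 'I_n} | wide #|A|].
  by apply/setP => A; rewrite !inE /wide andbC andbA.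
rewrite card_set_sizeP.
apply: (@leq_trans (\sum_(k < n.+1 | wide k) 'C(n, k0))).
  apply: leq_sum => k; rewrite /wide => wk; have [kn|kn] := leqP k.*2 n.
    by apply: leq_bin_half; lia.
  by rewrite -bin_sub -1?ltnS //; apply: leq_bin_half; lia.
rewrite sum_nat_const mulnA leq_mul2r; apply/orP; right.
(* The wide band has at most [2 * J * a + 1] layers, which is at most [3 * J * a] because [J * a] is
   positive. *)
apply: (@leq_trans (J * a).*2.+1); last by nia.
have : (#|[pred k : 'I_n.+1 | wide k]| <= (J * a).*2.+1)%N.
  by apply: (card_ord_itv n.+1 (n.+1./2 - J * a)); rewrite /wide => k; lia.
by [].
Qed.

(** Chebyshev for a uniform subset of ['I_n]: its size has variance [n / 4], so it deviates from
    [n / 2] by more than [b], where [b ^ 2 >= n], with probability at most 1/4. *)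
Lemma card_wide_middle_ge (n b : nat) :
  (0 < b)%N -> (n <= b ^ 2)%N -> (3 * 2 ^ n <= 4 * #|middle n b|)%N.
Proof.
move=> b0 nb; pose q : rat := 2^-1.
have := @variance_card rat 'I_n q [set: 'I_n].
rewrite cardsT card_ord.
have wE (F : {set 'I_n}) : bernoulli_weight q F = q ^+ n :> rat.
  rewrite /bernoulli_weight (eq_bigr (fun=> q)).
    by rewrite prodr_const; congr (_ ^+ _); exact: card_ord.
  by move=> i _; case: ifP => // _; rewrite /q; field.
under eq_bigr => F _ do rewrite wE finset.setIT.
rewrite -mulr_sumr => var.
have /= : (\sum_(F : {set 'I_n} | F \notin middle n b) (b%:R ^+ 2 : rat) <=
    \sum_(F : {set 'I_n}) (#|F|%:R - n%:R * q) ^+ 2).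
  rewrite big_mkcond; apply: ler_sum => F _; case: ifP => [|_]; last exact: sqr_ge0.
  rewrite inE negb_and -!ltnNge => Fb.
  have : (n%:R - #|F|%:R * 2 > b%:R * 2 :> rat) \/
         (#|F|%:R * 2 - n%:R > b%:R * 2 :> rat).
    case/orP: Fb => Fb; [left|right].
      by rewrite ltrBrDr -!natrM -natrD ltr_nat; lia.
    by rewrite ltrBrDr -!natrM -natrD ltr_nat; lia.
  have : 0 <= b%:R :> rat by [].
  by rewrite /q; move=> b_ge0 [H|H]; nra.
rewrite sumr_const -mulr_natr; set X := #|_| => H.
have X4 : (X * 4 <= 2 ^ n)%N.
  have b2_gt0 : 0 < b%:R ^+ 2 :> rat by rewrite exprn_gt0 ?ltr0n.
  rewrite -(ler_nat rat) natrM natrX -(ler_pM2l b2_gt0).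
  have : q ^+ n * 2 ^+ n = 1 by rewrite -exprMn mulVf ?expr1n.
  have : n%:R <= b%:R ^+ 2 :> rat by rewrite -natrX ler_nat.
  have : 0 < 2 ^+ n :> rat by rewrite exprn_gt0.
  move: var H; set M := \sum_(_ | _) _; set Q := q ^+ n.
  set N := 2 ^+ n => var H N0 nb' QN.
  have : M = N * (n%:R * (q * (1 - q))) by rewrite -var mulrA [N * _]mulrC QN mul1r.
  by rewrite /q; nra.
have : (#|middle n b| + X = 2 ^ n)%N.
  rewrite -[in RHS](card_ord n) -[in RHS]cardsT -card_powerset powersetT cardsT.
  by rewrite -(cardC (mem (middle n b))); congr addn; apply: eq_card.
by move: X4; move: #|middle n b| (2 ^ n)%N => m N; lia.
Qed.

(** * Complements, conflicting pairs and deletion *)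

(** A set and its complement meet in [0 < t] points, so [G] is disjoint from the family of
    complements of its members, which is equally large. *)
Lemma double_K_le (n t : nat) : (0 < t)%N -> ((K n t).*2 <= 2 ^ n)%N.
Proof.
move=> t0; rewrite -muln2 -leq_divRL //; apply/bigmax_leqP => G /andP[_ Gt].
rewrite leq_divRL // muln2 -addnn.
have injC := inv_inj (@finset.setCK 'I_n).
rewrite -[X in (_ + X)%N](card_imset _ injC) -cardsUI addnC.
have -> : G :&: [set finset.setC A | A in G] = finset.set0.
  apply/setP => A; rewrite !inE; apply/negP => /andP[AG].
  rewrite -[A]finset.setCK mem_imset // => CAG.
  have /forall_inP /(_ _ AG) /forall_inP /(_ _ CAG) := Gt.
  by rewrite finset.setICr cards0 leqNgt t0.
rewrite cards0 -[X in (_ <= 2 ^ X)%N](card_ord n) -[X in (_ <= 2 ^ X)%N]cardsT.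
by rewrite -card_powerset powersetT cardsT max_card.
Qed.

Definition bad_pairs {n : nat} (t : nat) (S : {set {set 'I_n}}) :
    {set {set 'I_n} * {set 'I_n}} :=
  [set e in finset.setX S S | (#|e.1 :&: e.2| < t)%N].

(** Keep the members of [F :&: S] that conflict with nothing in [F :&: S]. Every discarded set is
    the first entry of a bad pair inside [F]. *)
Lemma largest_t_intersecting_ge (n t : nat) (S F : {set {set 'I_n}}) :
  (#|F :&: S| <= largest_t_intersecting t F
                 + #|bad_pairs t S :&: finset.setX F F|)%N.
Proof.
set E := _ :&: finset.setX F F.
pose G := [set A in F :&: S | [forall B in F :&: S, (t <= #|A :&: B|)%N]].
rewrite -(cardsID G (F :&: S)); apply: leq_add.
  rewrite (finset.setIidPr _); last first.
    by apply/fintype.subsetP => A; rewrite inE => /andP[].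
  apply: (@leq_bigmax_cond _ _ (fun G : {set {set 'I_n}} => #|G|)).
  apply/andP; split.
    by apply/fintype.subsetP => A; rewrite !inE => /andP[/andP[]].
  apply/forall_inP => A; rewrite inE => /andP[_ /forall_inP AG].
  by apply/forall_inP => B; rewrite inE => /andP[BFS _]; apply: AG.
apply: leq_trans (leq_imset_card fst E); apply/subset_leq_card/fintype.subsetP => A.
rewrite inE => /andP[+ AFS]; rewrite inE AFS /= => /forall_inPn[B].
move: AFS; rewrite !inE -ltnNge => /andP[AF AS] /andP[BF BS] ABt.
by apply/imsetP; exists (A, B); rewrite // !inE /= AF AS BF BS ABt.
Qed.

(** The set [d A B] on which [A] and [B] agree determines [B] once [A] is known. Its size is
    [2 |A :&: B| + n - |A| - |B|], less than [2 (a + t)] for a bad pair, so few sets [B] are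
    possible. *)
Lemma card_bad_pairs (n a t : nat) :
  (#|bad_pairs t (upper n a)| <= #|upper n a| * n.+1 ^ (2 * (a + t)))%N.
Proof.
pose d (A B : {set 'I_n}) := (A :&: B) :|: ~: (A :|: B).
pose h (e : {set 'I_n} * {set 'I_n}) := (e.1, d e.1 e.2).
have h_inj : injective h.
  move=> [A B] [A' B'] [<-] /setP dE; congr pair; apply/setP => x.
  by have := dE x; rewrite !inE; do !case: (x \in _).
have dP (A B : {set 'I_n}) : (n <= (#|A| + a).*2)%N -> (n <= (#|B| + a).*2)%N ->
    (#|A :&: B| < t)%N -> (#|d A B| <= 2 * (a + t))%N.
  have := cardsC (A :|: B); have := cardsUI A B; rewrite card_ord.
  have [+ _] := leq_card_setU (A :&: B) (~: (A :|: B)); rewrite /d.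
  by lia.
rewrite -(card_imset _ h_inj).
pose small := [set D : {set 'I_n} | (#|D| <= 2 * (a + t))%N].
apply: (@leq_trans (#|upper n a| * #|small|)); last first.
  rewrite leq_mul2l; apply/orP; right.
  by have := card_small_sets 'I_n (2 * (a + t)); rewrite card_ord.
rewrite -cardsX; apply/subset_leq_card/fintype.subsetP => _ /imsetP[[A B] + ->].
rewrite !inE /= => /andP[/andP[An Bn] ABt]; rewrite An /=.
exact: dP.
Qed.

(** * Probability of failure for fixed [n] *)

Lemma Pr_Pnp_ge0 (R : realType) (n : nat) (p : R) (E : pred {set {set 'I_n}}) :
  0 <= p <= 1 -> 0 <= Pr_Pnp p E.
Proof. by move=> p01; apply: sumr_ge0 => F _; apply: bernoulli_weight_ge0. Qed.

Lemma Pr_Pnp_compl (R : realType) (n : nat) (p : R) (E : pred {set {set 'I_n}}) :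
  1 - Pr_Pnp p E = Pr_Pnp p (predC E).
Proof.
rewrite -(Pr_PnpT n p) /Pr_Pnp (bigID E) /= addrC addrK.
by apply: eq_bigl => F.
Qed.

Lemma Pr_Pnp_markov (R : realType) (n : nat) (p : R) (E : pred {set {set 'I_n}})
    (f : {set {set 'I_n}} -> R) :
  0 <= p <= 1 -> (forall F, 0 <= f F) -> (forall F, E F -> 1 <= f F) ->
  Pr_Pnp p E <= \sum_F bernoulli_weight p F * f F.
Proof.
move=> p01 f0 f1; rewrite /Pr_Pnp big_mkcond; apply: ler_sum => F _.
have w0 := bernoulli_weight_ge0 _ _ _ F p01.
case: ifP => [/f1 fF|_]; last exact: mulr_ge0.
by rewrite -[leLHS]mulr1 ler_wpM2l.
Qed.

Lemma Pr_small_family (R : realType) (n t a : nat) (p d : R) :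
  0 < p <= 1 -> 0 < d -> (0 < t)%N -> (2 * (a + t) <= n)%N ->
  8 * d * 2 ^+ n <= #|middle n a|%:R ->
  1 - Pr_Pnp p (fun F : {set {set 'I_n}} =>
        (1 + 4 * d) * p * (K n t)%:R <= (largest_t_intersecting t F)%:R)
    <= (d ^+ 2 * (p * 2 ^+ n))^-1 + p * n.+1%:R ^+ (2 * (a + t)) / d.
Proof.
move=> /andP[p0 p1] d0 t0 atn dmid.
have p01 : 0 <= p <= 1 by rewrite ltW.
set N : R := 2 ^+ n in dmid *.
have N0 : 0 < N by rewrite exprn_gt0.
set S := upper n a; set s : R := #|S|%:R; pose E := bad_pairs t S.
have u0 : 0 < d * p * N by rewrite !mulr_gt0.
have sN : s <= N.
  rewrite /N -natrX ler_nat -[X in (2 ^ X)%N](card_ord n) -[X in (2 ^ X)%N]cardsT.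
  by rewrite -card_powerset powersetT cardsT max_card.
have s_ge : (1 + 8 * d) * N <= 2 * s.
  have := card_upper n a => /(congr1 (fun k => k%:R : R)).
  by rewrite -muln2 natrM natrD natrX -/S -/s -/N; lra.
have K_le : 2 * (K n t)%:R <= N.
  by rewrite /N -natrX -natrM ler_nat mul2n double_K_le.
rewrite Pr_Pnp_compl.
(* One test function for both bounds: the first term is Chebyshev for [#|F :&: S|], the second
   Markov for the number of bad pairs in [F]. *)
pose f (F : {set {set 'I_n}}) : R :=
  (#|F :&: S|%:R - s * p) ^+ 2 / (d * p * N) ^+ 2
  + #|E :&: finset.setX F F|%:R / (d * p * N).
apply: (@le_trans _ _ (\sum_F bernoulli_weight p F * f F)).
  apply: Pr_Pnp_markov => // F.
    by rewrite addr_ge0 // mulr_ge0 ?sqr_ge0 // invr_ge0 ?sqr_ge0 // ltW.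
  rewrite /= -ltNge => Fsmall.
  have := largest_t_intersecting_ge n t S F; rewrite -(ler_nat R) natrD -/E.
  rewrite /f; move: (ler0n R #|E :&: finset.setX F F|).
  move: (#|F :&: S|%:R : R) (#|E :&: _|%:R : R).
  move: Fsmall; set L : R := (largest_t_intersecting t F)%:R => Fsmall X Y Y0 XLY.
  set u := d * p * N in u0 *.
  (* The mean [s * p] is at least [(1 + 8 * d) * p * N / 2], while failure means
     [L < (1 + 4 * d) * p * N / 2]. The difference is [2 * u], so either [Y] or the shortfall
     [s * p - X] is at least [u]. *)
  have gap : 2 * u <= s * p - X + Y.
    have : (1 + 4 * d) * p * (2 * (K n t)%:R) <= (1 + 4 * d) * p * N.
      by rewrite ler_pM2l // mulr_gt0 // addr_gt0 // mulr_gt0.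
    have : p * ((1 + 8 * d) * N) <= p * (2 * s) by rewrite ler_pM2l.
    rewrite /u; lra.
  have [uY|Yu] := leP u Y.
    rewrite -[leLHS]add0r lerD //; first by rewrite mulr_ge0 ?invr_ge0 ?sqr_ge0.
    by rewrite ler_pdivlMr // mul1r.
  rewrite -[leLHS]addr0 lerD //; last by rewrite mulr_ge0 // invr_ge0 ltW.
  have uX : u <= s * p - X by lra.
  rewrite ler_pdivlMr ?exprn_gt0 // mul1r -opprB sqrrN.
  by rewrite ler_sqr ?nnegrE ?(ltW u0) // (le_trans (ltW u0)).
under eq_bigr => F _ do rewrite mulrDr mulrA [X in _ + X]mulrA.
rewrite big_split -!mulr_suml /= /s variance_card -/s mean_card_pairs; last first.
  (* Members of [S] have at least [n / 2 - a >= t] elements, so no set forms a bad pair with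
     itself. *)
  move=> [A B]; rewrite !inE /= => /andP[/andP[nA _] ABt]; apply/eqP => AB.
  by move: ABt; rewrite -AB finset.setIid; lia.
apply: lerD.
  rewrite ler_pdivrMr ?exprn_gt0 //.
  have -> : (d ^+ 2 * (p * N))^-1 * (d * p * N) ^+ 2 = N * p.
    by field; rewrite !gt_eqF.
  by rewrite ler_pM ?mulr_ge0 ?subr_ge0 //; nra.
rewrite ler_pdivrMr //.
have -> : p * n.+1%:R ^+ (2 * (a + t)) / d * (d * p * N) =
   N * n.+1%:R ^+ (2 * (a + t)) * p ^+ 2 by field; rewrite gt_eqF.
rewrite ler_wpM2r ?sqr_ge0 //.
apply: (@le_trans _ _ (s * n.+1%:R ^+ (2 * (a + t)))).
  by rewrite -natrX -natrM ler_nat card_bad_pairs.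
by rewrite ler_wpM2r // exprn_ge0.
Qed.

(** * Asymptotic estimates and conclusion *)

Lemma log2_nat_ge0 (R : realType) (n : nat) : (0 < n)%N -> 0 <= log2 n%:R :> R.
Proof. by move=> n0; apply: divr_ge0; apply: ln_ge0; rewrite ler1n. Qed.

(** From [n + 1 <= n ^ 2] the power is at most [expR (8 * x * ln n)], while [p] is at most
    [expR (- 100 * x * ln n)], the factor [ln 2] cancelling. Since [x >= 1], there is ample room for
    [1 / n]. *)
Lemma bad_degree_le (R : realType) (n k : nat) (p x : R) :
  (2 <= n)%N -> k%:R <= 4 * x -> 1 <= x ->
  p <= 2 `^ (- (100 * x * log2 n%:R)) ->
  p * n.+1%:R ^+ k <= n%:R^-1.
Proof.
move=> n2 kx x1; have n_gt0 : 0 < n%:R :> R by rewrite ltr0n; lia.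
have ln2 : 0 < ln 2 :> R by rewrite ln_gt0 // ltr1n.
have L0 : 0 <= ln n%:R :> R by rewrite ln_ge0 // ler1n; lia.
rewrite /powR pnatr_eq0 /= /log2 => p_le.
have e1 : n%:R = expR (ln n%:R) :> R by rewrite lnK // posrE.
have nk : n.+1%:R ^+ k <= expR (8 * x * ln n%:R).
  apply: (@le_trans _ _ ((n%:R ^+ 2) ^+ k)).
    by apply: lerXn2r; rewrite ?nnegrE ?exprn_ge0 // -natrX ler_nat; nia.
  rewrite -exprM e1 -expRM_natl expRK ler_expR natrM; nra.
apply: (le_trans (ler_wpM2r _ p_le)); first exact: exprn_ge0.
apply: (le_trans (ler_wpM2l (expR_ge0 _) nk)).
rewrite -expRD [in leRHS]e1 -expRN ler_expR.
have -> : - (100 * x * (ln n%:R / ln 2)) * ln 2 = - (100 * x * ln n%:R).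
  by field; rewrite gt_eqF.
nra.
Qed.

(** A band of half-width [J * a >= sqrt n] holds 3/4 of the cube, and narrowing it to [a] costs a
    factor at most [3 * J + 1]. *)
Lemma card_middle_ge (R : realType) (n a J : nat) :
  (0 < J)%N -> (0 < a)%N -> (a.*2 <= n)%N ->
  Num.sqrt n%:R <= (J * a)%:R :> R ->
  3 / (4 * (3 * J%:R + 1)) * 2 ^+ n <= #|middle n a|%:R :> R.
Proof.
move=> J0 a0 an nJa.
have nJa2 : (n <= (J * a) ^ 2)%N.
  rewrite -(ler_nat R) natrX -[leLHS]sqr_sqrtr //.
  by apply: lerXn2r; rewrite ?nnegrE ?sqrtr_ge0.
have wide : (3 * 2 ^ n <= 4 * ((3 * J + 1) * #|middle n a|))%N.
  apply: leq_trans (card_wide_middle_ge _ _ _ nJa2) _; first by rewrite muln_gt0 J0.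
  by rewrite leq_mul2l card_wide_middle.
have J1 : 0 < 4 * (3 * J%:R + 1) :> R by rewrite mulr_gt0 // ltr_wpDl ?mulr_ge0.
rewrite mulrAC ler_pdivrMr // mulrC.
move: wide; rewrite -(ler_nat R) !natrM natrD natrM natrX; lra.
Qed.

Local Open Scope classical_set_scope.

Theorem theorem6p3 (R : realType) (C : R) (hC : 0 < C) :
  exists eps : R, 0 < eps /\
    forall (p omega : nat -> R) (t : nat -> nat),
      (\forall n \near \oo,
         p n < 2 `^ (- (100 * C * Num.sqrt n%:R * log2 n%:R))) ->
      omega n @[n --> \oo] --> +oo ->
      (\forall n \near \oo, omega n / 2 ^+ n <= p n) ->
      (\forall n \near \oo, (0 < t n)%N /\ (t n)%:R <= C * Num.sqrt n%:R) ->
      Pr_Pnp (p n) (fun F : {set {set 'I_n}} =>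
          (1 + eps) * p n * (K n (t n))%:R
            <= (largest_t_intersecting (t n) F)%:R)
        @[n --> \oo] --> (1 : R).
Proof.
(* With [x = C * sqrt n] and [a] its integer part, [J * C >= 2] and [x <= 2 * a] give
   [J * a >= sqrt n]. *)
pose J := (Num.truncn (2 / C)).+1.
have JC : 2 <= J%:R * C.
  rewrite -ler_pdivrMr // ltW //; apply: truncnS_gt.
pose d : R := 3 / (4 * (3 * J%:R + 1)) / 8.
have d0 : 0 < d by rewrite /d !divr_gt0 // mulr_gt0 // ltr_wpDl ?mulr_ge0.
exists (4 * d); split; first exact: mulr_gt0.
move=> p omega t p_small omega_oo p_large t_small.
apply/cvgrPdist_le => e e0.
(* The bound 1 makes [p n] positive; the other makes the Chebyshev term at most [e / 2]. *)
have omega_big : \forall n \near \oo, Num.max 1 (2 / (d ^+ 2 * e)) <= omega n.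
  by move/cvgryPge: omega_oo; apply.
near=> n.
have sq_n (M : R) : 0 <= M -> M ^+ 2 <= n%:R -> M <= Num.sqrt n%:R.
  by move=> M0 Mn; rewrite -(ger0_norm M0) -sqrtr_sqr ler_wsqrtr.
set x := C * Num.sqrt n%:R.
have n2 : (2 <= n)%N by near: n; exact: nbhs_infty_ge.
have sqrt_ge1 : 2 / C <= Num.sqrt n%:R.
  by apply: sq_n; [rewrite divr_ge0 // ltW|near: n; exact: nbhs_infty_ger].
(* This yields [2 * (a + t n) <= 4 * x <= n]. *)
have sqrt_ge2 : 4 * C <= Num.sqrt n%:R.
  by apply: sq_n; [rewrite mulr_ge0 // ltW|near: n; exact: nbhs_infty_ger].
have x2 : 2 <= x by rewrite /x mulrC -ler_pdivrMr.
have [t0 tx] : (0 < t n)%N /\ (t n)%:R <= C * Num.sqrt n%:R.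
  by near: n; exact: t_small.
rewrite -/x in tx.
have /andP[ax xa] : (Num.truncn x)%:R <= x < (Num.truncn x).+1%:R.
  by apply: truncn_itv; lra.
set a := Num.truncn x in ax xa.
have a0 : (0 < a)%N by rewrite truncn_gt0; lra.
have atx : (2 * (a + t n))%:R <= 4 * x :> R by rewrite natrM natrD; lra.
have atn : (2 * (a + t n) <= n)%N.
  rewrite -(ler_nat R); apply: (le_trans atx).
  have -> : n%:R = Num.sqrt n%:R * Num.sqrt n%:R :> R by rewrite -expr2 sqr_sqrtr.
  by rewrite /x mulrA ler_wpM2r // sqrtr_ge0.
have mid : 8 * d * 2 ^+ n <= #|middle n a|%:R :> R.
  have -> : 8 * d = 3 / (4 * (3 * J%:R + 1)) by rewrite /d mulrC divfK.
  apply: card_middle_ge => //.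
    by apply: leq_trans atn; rewrite mul2n leq_double leq_addr.
  rewrite natrM; have : 2 * Num.sqrt n%:R <= J%:R * x.
    by rewrite /x mulrA ler_wpM2r // sqrtr_ge0.
  have : x <= 2 * a%:R by rewrite -natr1 in xa; lra.
  have : 0 < J%:R :> R by rewrite ltr0n.
  nra.
have [om1 om2] : 1 <= omega n /\ 2 / (d ^+ 2 * e) <= omega n.
  by apply/andP; rewrite -ge_max; near: n; exact: omega_big.
have p_ge : omega n / 2 ^+ n <= p n by near: n; exact: p_large.
have N0 : 0 < 2 ^+ n :> R by rewrite exprn_gt0.
have p0 : 0 < p n by apply: lt_le_trans p_ge; rewrite divr_gt0 //; lra.
have p_lt : p n < 2 `^ (- (100 * x * log2 n%:R)).
  by rewrite /x [100 * _]mulrA; near: n; exact: p_small.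
have deg : p n * n.+1%:R ^+ (2 * (a + t n)) <= n%:R^-1.
  by apply: (bad_degree_le _ _ _ _ x) => //; [lra|exact: ltW].
have p1 : p n <= 1.
  rewrite (le_trans (ltW p_lt)) // -[leRHS](powRr0 2) ler_powR ?ler1n // oppr_le0.
  apply: mulr_ge0; first lra.
  exact/log2_nat_ge0/ltnW.
have p01 : 0 < p n <= 1 by rewrite p0.
have fail := Pr_small_family R n (t n) a (p n) d p01 d0 t0 atn mid.
rewrite ger0_norm; last first.
  by rewrite Pr_Pnp_compl Pr_Pnp_ge0 // ltW.
apply: (le_trans fail).
have -> : e = e / 2 + e / 2 by field.
apply: lerD.
  have dp : d ^+ 2 * (2 / (d ^+ 2 * e)) <= d ^+ 2 * (p n * 2 ^+ n).
    rewrite ler_pM2l ?exprn_gt0 //; apply: le_trans om2 _.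
    by rewrite -ler_pdivrMr.
  have de : d ^+ 2 * (2 / (d ^+ 2 * e)) = (e / 2)^-1.
    by field; rewrite !gt_eqF.
  rewrite -[leRHS]invrK -de lef_pV2 ?posrE //.
    by rewrite !mulr_gt0 // exprn_gt0.
  by rewrite de invr_gt0 divr_gt0.
(* The conflict term is at most [1 / (n * d)], which is at most [e / 2] for large [n]. *)
rewrite ler_pdivrMr //; apply: (le_trans deg).
rewrite -[leRHS]invrK lef_pV2 ?posrE ?invr_gt0 ?mulr_gt0 ?divr_gt0 //.
  by near: n; exact: nbhs_infty_ger.
by rewrite ltr0n ltnW.
Unshelve. all: by end_near.
Qed.
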